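(* Let $X$ and $Z$ be disjoint finite sets, let $Q$ be a partial order relation on $Z$, and let $y$ be a point not contained in $X \cup Z$. Then the following two numbers are equal: (i) the number of partial order relations $R$ on $X \cup Z$ with $R|_Z = Q$; (ii) the number of partial order relations $R$ on $X \cup Z \cup \{y\}$ with $R|_{Z \cup \{y\}} = Q^d + A_y$ and $\max R = \max(Q^d + A_y)$ (i.e. the maximal points of $R$ are exactly the maximal points of $Q^d$ together with $y$).
   Context: A partial order relation (p.o.r.) on a set $S$ is a reflexive, antisymmetric and transitive subset of $S \times S$. For a p.o.r. $R$ on $S$ and $M \subseteq S$, the induced p.o.r. is $R|_M = R \cap (M \times M)$ (so $R|_M = Q$ means $Q$ is an induced sub-poset of $R$). The dual of $R$ is $R^d = \{(b,a) : (a,b) \in R\}$. $A_y = \{(y,y)\}$ is the singleton poset on $y$. For p.o.r.s $R_1, R_2$ on disjoint carriers, the direct sum is $R_1 + R_2 = R_1 \cup R_2$. For a p.o.r. $R$ on $S$, $\max R$ is the set of $x \in S$ such that $(x,z) \in R$ implies $z = x$. *)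

(* Defs.v *)
From mathcomp Require Import all_boot.

Set Implicit Arguments.
Unset Strict Implicit.
Unset Printing Implicit Defensive.

(* The finite sets are subsets of an ambient finite
   type T, and a relation is the set of its pairs, of type {set T * T}; the
   membership (a, b) \in R reads "a is below b". *)

Definition is_por (T : finType) (S : {set T}) (R : {set T * T}) : bool :=
  [&& R \subset setX S S,
      [forall a in S, (a, a) \in R],
      [forall a, forall b, ((a, b) \in R) && ((b, a) \in R) ==> (a == b)] &
      [forall a, forall b, forall c,
         ((a, b) \in R) && ((b, c) \in R) ==> ((a, c) \in R)]].

Definition por_restr (T : finType) (R : {set T * T}) (M : {set T}) :
  {set T * T} := R :&: setX M M.

Definition por_dual (T : finType) (R : {set T * T}) : {set T * T} :=
  [set (p.2, p.1) | p in R].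

Definition por_point (T : finType) (y : T) : {set T * T} := [set (y, y)].

(* Meant for relations on disjoint carriers. *)
Definition por_sum (T : finType) (R1 R2 : {set T * T}) : {set T * T} :=
  R1 :|: R2.

(* The carrier S is explicit: a point of T outside S satisfies the condition
   on R vacuously. *)
Definition por_max (T : finType) (S : {set T}) (R : {set T * T}) : {set T} :=
  [set a in S | [forall b, ((a, b) \in R) ==> (b == a)]].

(* Main.v *)
(* Given R as in (i), let W be the up-set generated by Z together with an
   isolated point y, and let D be the rest of the carrier, a down-set.  Dualize R
   on W and on D separately, and replace the set of related pairs in D x W by its
   complement.  Then y lies above exactly the points of D (and itself), so that W
   can be read off the new relation.  The operation is an involution for fixed W,
   and it exchanges "every point of W is above a point of Z or equal to y" with
   "every point of W is below a point of Z or equal to y", which is the condition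
   on the maximal points in (ii). *)
Require Import Defs.
From mathcomp Require Import all_boot.

Set Implicit Arguments.
Unset Strict Implicit.
Unset Printing Implicit Defensive.

Section PartialOrders.

Variable T : finType.
Implicit Types (S W M Z : {set T}) (R Q : {set T * T}).

(** * Partial orders: membership, duals, restrictions and maximal points *)

Lemma porP S R :
  reflect [/\ forall a b, (a, b) \in R -> a \in S /\ b \in S,
              forall a, a \in S -> (a, a) \in R,
              forall a b, (a, b) \in R -> (b, a) \in R -> a = b &
              forall a b c, (a, b) \in R -> (b, c) \in R -> (a, c) \in R]
          (is_por S R).
Proof.
apply: (iffP and4P) => [[/subsetP sub /forall_inP refl /forallP anti /forallP trans]
                       | [sub refl anti trans]]; split=> //.
- by move=> a b /sub; rewrite inE => /andP.
- move=> a b ab ba; apply/eqP.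
  by move: (forallP (anti a) b); rewrite ab ba.
- move=> a b c ab bc.
  by move: (forallP (forallP (trans a) b) c); rewrite ab bc.
- by apply/subsetP=> -[a b] /sub[aS bS]; rewrite inE /= aS.
- exact/forall_inP.
- by apply/forallP=> a; apply/forallP=> b; apply/implyP=> /andP[ab /(anti a b ab)->].
- apply/forallP=> a; apply/forallP=> b; apply/forallP=> c.
  by apply/implyP=> /andP[]; apply: trans.
Qed.

Lemma in_por_restr R M a b :
  ((a, b) \in por_restr R M) = [&& (a, b) \in R, a \in M & b \in M].
Proof. by rewrite !inE. Qed.

Lemma in_por_dual R a b : ((a, b) \in por_dual R) = ((b, a) \in R).
Proof.
apply/imsetP/idP => [[[c d] cdR [-> ->]] // | baR].
by exists (b, a).
Qed.

Lemma por_maxP S R a :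
  reflect (a \in S /\ forall b, (a, b) \in R -> b = a) (a \in por_max S R).
Proof.
rewrite inE; apply: (iffP andP) => -[aS amax]; split=> //.
  by move=> b ab; apply/eqP; apply: (implyP (forallP amax b)).
by apply/forallP=> b; apply/implyP=> /amax->.
Qed.

Lemma por_restr_por S M R : M \subset S -> is_por S R -> is_por M (por_restr R M).
Proof.
move=> /subsetP MS /porP[sub refl anti trans]; apply/porP; split.
- by move=> a b; rewrite in_por_restr => /and3P[].
- by move=> a aM; rewrite in_por_restr aM refl ?MS.
- by move=> a b; rewrite !in_por_restr => /and3P[ab _ _] /and3P[ba _ _]; apply: anti.
- move=> a b c; rewrite !in_por_restr => /and3P[ab -> _] /and3P[bc _ ->].
  by rewrite (trans _ _ _ ab bc).
Qed.

(** Among the points above [a], take an [m] with the fewest points above it. A point above [m] then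
    has the same points above it as [m], and antisymmetry identifies the two. *)
Lemma por_exists_max S R a : is_por S R -> a \in S ->
  exists2 m, (a, m) \in R & m \in por_max S R.
Proof.
move=> /porP[sub refl anti trans] aS.
pose above m := [set c | (m, c) \in R].
have [m am mmin] := @arg_minnP T a (fun m => (a, m) \in R) (fun m => #|above m|) (refl a aS).
exists m => //; apply/por_maxP; split; first by have [] := sub _ _ am.
move=> b mb; have [mS bS] := sub _ _ mb.
have sub_above: above b \subset above m.
  by apply/subsetP=> c; rewrite !inE; apply: trans.
have eq_above: above b = above m.
  by apply/eqP; rewrite eqEcard sub_above mmin ?(trans _ _ _ am mb).
have: m \in above b by rewrite eq_above inE refl.
by rewrite inE => bm; apply: anti.
Qed.

(** * Flipping a relation along an up-set *)

Definition upset W R := forall a b, (a, b) \in R -> a \in W -> b \in W.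

(** The conjunct [p.2 \in W] admits crossing pairs only into [W], so that [W] is an up-set of the
    result as well. *)
Definition flip S W R : {set T * T} :=
  [set p in setX S S |
    if (p.1 \in W) == (p.2 \in W) then (p.2, p.1) \in R
    else (p.2 \in W) && (p \notin R)].

Lemma in_flip S W R a b :
  ((a, b) \in flip S W R) =
  [&& a \in S, b \in S &
      if (a \in W) == (b \in W) then (b, a) \in R
      else (b \in W) && ((a, b) \notin R)].
Proof. by rewrite !inE /= andbA. Qed.

Lemma upset_flip S W R : upset W (flip S W R).
Proof. by move=> a b; rewrite in_flip => /and3P[_ _]; do 2!case: (_ \in W). Qed.

(** Transitivity is the main point. If a chain [a], [b], [c] enters [W], one step crosses and the
    other is reversed; were [(a, c)] in [R], composing it with the reversed step would put the
    crossing pair into [R]. *)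
Lemma flip_por S W R : upset W R -> is_por S R -> is_por S (flip S W R).
Proof.
move=> upW /porP[sub refl anti trans]; apply/porP; split.
- by move=> a b; rewrite in_flip => /and3P[].
- by move=> a aS; rewrite in_flip aS eqxx refl.
- move=> a b; rewrite !in_flip => /and3P[_ _ ab] /and3P[_ _ ba].
  move: ab ba; do 2!case: (_ \in W) => //=; move=> ab ba; exact: anti.
- move=> a b c; rewrite !in_flip => /and3P[-> bS ab] /and3P[_ -> bc] /=.
  move: ab bc; case: (a \in W); case: (b \in W); case: (c \in W) => //= ab bc.
  + exact: trans bc ab.
  + by apply: contra ab => ac; apply: trans ac bc.
  + by apply: contra bc => ac; apply: trans ab ac.
  + exact: trans bc ab.
Qed.

(** An up-set has no pair of [R] leaving it, so no pair is lost when the crossing pairs are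
    complemented twice. *)
Lemma flipK S W R : upset W R -> is_por S R -> flip S W (flip S W R) = R.
Proof.
move=> upW /porP[sub _ _ _]; apply/setP=> -[a b]; rewrite !in_flip.
have [abR|abR] := boolP ((a, b) \in R).
  have [aS bS] := sub _ _ abR; rewrite aS bS /=.
  by have:= upW _ _ abR; case: (a \in W); case: (b \in W) => // /(_ isT).
by case: (a \in S); case: (b \in S); case: (a \in W); case: (b \in W).
Qed.

Lemma leq_card_can (U V : finType) (A : {set U}) (B : {set V})
    (f : U -> V) (g : V -> U) :
  {in A, forall u, f u \in B} -> {in A, cancel f g} -> #|A| <= #|B|.
Proof.
move=> fAB fK; rewrite -(card_in_imset (can_in_inj fK)).
by apply: subset_leq_card; apply/subsetP=> _ /imsetP[u uA ->]; apply: fAB.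
Qed.

End PartialOrders.

(** * The two families of relations and the maps between them *)

Section Bijection.

Variables (T : finType) (S Z : {set T}) (Q : {set T * T}) (y : T).
Hypotheses (ZS : Z \subset S) (porQ : is_por Z Q) (yS : y \notin S).

Let Sy := S :|: [set y].
Let Zy := Z :|: [set y].
Let Qy := por_sum (por_dual Q) (por_point y).

Definition extensions :=
  [set R : {set T * T} | is_por S R & por_restr R Z == Q].

Definition pointed_extensions :=
  [set R : {set T * T} |
    [&& is_por Sy R, por_restr R Zy == Qy & por_max Sy R == por_max Zy Qy]].

Definition above_Z (R : {set T * T}) : {set T} :=
  y |: [set w | [exists z in Z, (z, w) \in R]].

(** Recovers [above_Z] from the flipped relation. The point [y] is inserted by hand, since it lies
    below itself. *)
Definition not_below_y (R : {set T * T}) : {set T} :=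
  y |: [set w in S | (w, y) \notin R].

Definition add_point (R : {set T * T}) : {set T * T} :=
  flip Sy (above_Z R) (por_sum R (por_point y)).

Definition remove_point (R : {set T * T}) : {set T * T} :=
  por_restr (flip Sy (not_below_y R) R) S.

Lemma in_por_sum_point (R : {set T * T}) a b :
  ((a, b) \in por_sum R (por_point y)) = ((a, b) \in R) || (a == y) && (b == y).
Proof. by rewrite !inE xpair_eqE. Qed.

Lemma in_Qy a b : ((a, b) \in Qy) = ((b, a) \in Q) || (a == y) && (b == y).
Proof. by rewrite in_por_sum_point in_por_dual. Qed.

Lemma in_Sy a : (a \in Sy) = (a \in S) || (a == y).
Proof. by rewrite !inE. Qed.

Lemma in_Zy a : (a \in Zy) = (a \in Z) || (a == y).
Proof. by rewrite !inE. Qed.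

Lemma neq_y a : a \in S -> (a == y) = false.
Proof. by move=> aS; apply: contraNF yS => /eqP<-. Qed.

Lemma above_ZP (R : {set T * T}) w :
  reflect (w = y \/ exists2 z, z \in Z & (z, w) \in R) (w \in above_Z R).
Proof.
rewrite !inE; apply: (iffP orP) => -[].
- by move/eqP; left.
- by case/exists_inP=> z zZ zw; right; exists z.
- by move->; left.
- by case=> z zZ zw; right; apply/exists_inP; exists z.
Qed.

(** * Adjoining the point *)

Lemma por_sum_point (R : {set T * T}) :
  is_por S R -> is_por Sy (por_sum R (por_point y)).
Proof.
move=> /porP[sub refl anti trans].
have nR a : ((a, y) \in R = false) * ((y, a) \in R = false).
  by split; apply: contraNF yS => /sub[].
apply/porP; split.
- move=> a b; rewrite in_por_sum_point !in_Sy => /orP[/sub[-> ->]//|/andP[-> ->]].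
  by rewrite !orbT.
- by move=> a; rewrite in_Sy in_por_sum_point => /orP[/refl->//|->]; rewrite orbT.
- move=> a b; rewrite !in_por_sum_point => /orP[ab|/andP[/eqP-> /eqP->]//].
  by case/orP=> [ba|/andP[/eqP-> /eqP->]//]; apply: anti.
- move=> a b c; rewrite !in_por_sum_point => /orP[ab|/andP[/eqP-> /eqP->]//].
  case/orP=> [bc|/andP[/eqP eb _]]; first by rewrite (trans _ _ _ ab bc).
  by rewrite eb nR in ab.
Qed.

Lemma upset_above_Z (R : {set T * T}) :
  is_por S R -> upset (above_Z R) (por_sum R (por_point y)).
Proof.
move=> /porP[sub refl anti trans] a b; rewrite in_por_sum_point.
case/orP=> [ab|/andP[_ /eqP->] _]; last by apply/above_ZP; left.
case/above_ZP=> [ay|[z zZ za]]; first by move: yS; rewrite -ay (sub _ _ ab).1.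
by apply/above_ZP; right; exists z => //; apply: trans za ab.
Qed.

Lemma above_Z_Zy (R : {set T * T}) a : is_por S R -> a \in Zy -> a \in above_Z R.
Proof.
move=> /porP[sub refl anti trans]; rewrite in_Zy => /orP[aZ|/eqP->].
  by apply/above_ZP; right; exists a => //; apply/refl/(subsetP ZS).
by apply/above_ZP; left.
Qed.

Lemma above_Z_Sy (R : {set T * T}) a : is_por S R -> a \in above_Z R -> a \in Sy.
Proof.
move=> /porP[sub _ _ _] /above_ZP[->|[z zZ /sub[_ aS]]]; rewrite in_Sy ?eqxx ?orbT //.
by rewrite aS.
Qed.

Lemma Zy_sub_Sy a : a \in Zy -> a \in Sy.
Proof. by rewrite in_Zy in_Sy => /orP[/(subsetP ZS)->|->] //; rewrite orbT. Qed.

Lemma add_point_above (R : {set T * T}) a b :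
    is_por S R -> a \in above_Z R -> b \in above_Z R ->
  ((a, b) \in add_point R) = ((b, a) \in R) || (b == y) && (a == y).
Proof.
move=> porR aW bW.
by rewrite in_flip aW bW !(above_Z_Sy porR) // in_por_sum_point.
Qed.

(** All of [Zy] lies in [above_Z R], where the flip is plain dualization; this gives the
    restriction. The maximal points are compared by two inclusions. *)
Lemma add_point_pointed (R : {set T * T}) :
  R \in extensions -> add_point R \in pointed_extensions.
Proof.
rewrite inE => /andP[porR /eqP RZ].
have porR' := flip_por (upset_above_Z porR) (por_sum_point porR).
have := porR => /porP[sub refl anti trans].
have yNR a : (y, a) \in R = false by apply: contraNF yS => /sub[].
have Nyr a : (a, y) \in R = false by apply: contraNF yS => /sub[].
have R'Z : por_restr (add_point R) Zy = Qy.
  apply/setP=> -[a b]; rewrite in_por_restr in_Qy -RZ in_por_restr.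
  apply/and3P/idP => [[ab aZ bZ]|].
    move: ab; rewrite add_point_above ?above_Z_Zy //.
    case/orP=> [ba|/andP[-> ->]]; last by rewrite orbT.
    move: aZ bZ ba; rewrite !in_Zy => /orP[->|/eqP->]; last by rewrite Nyr.
    by case/orP=> [->|/eqP->]; [move=> -> | rewrite yNR].
  move=> ab; have [aZ bZ]: a \in Zy /\ b \in Zy.
    by rewrite !in_Zy; case/orP: ab => [/and3P[_ -> ->]|/andP[-> ->]]; rewrite ?orbT.
  split=> //; rewrite add_point_above ?above_Z_Zy //.
  by case/orP: ab => [/and3P[-> _ _]//|/andP[-> ->]]; rewrite orbT.
rewrite inE porR' R'Z eqxx /=; apply/eqP/setP=> a.
apply/por_maxP/por_maxP => [[aS amax]|[aZ amax]]; last first.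
  split=> [|b ab]; first exact: Zy_sub_Sy.
  have aW := above_Z_Zy porR aZ.
  have bW := upset_flip ab aW.
  move: ab; rewrite add_point_above // => /orP[ba|/andP[/eqP-> /eqP->]//].
  (* In [R] now z <= b <= a with [z] in [Z]; maximality of [a] in [Qy] gives z = a, which squeezes
     [b] to [a]. *)
  case/above_ZP: bW => [ey|[z zZ zb]]; first by rewrite ey yNR in ba.
  have za := trans _ _ _ zb ba.
  have aZ0 : a \in Z.
    by move: aZ; rewrite in_Zy => /orP[//|/eqP ey]; rewrite ey Nyr in ba.
  have ez : z = a by apply: amax; rewrite in_Qy -RZ in_por_restr za zZ aZ0.
  by apply: anti => //; rewrite -ez.
(* A point outside [above_Z R] is unrelated to the isolated [y], so the flip puts it below [y] and
   it is not maximal. *)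
have aW : a \in above_Z R.
  apply/negPn/negP=> aW.
  have yW : y \in above_Z R by apply/above_ZP; left.
  have ay : (a, y) \in add_point R.
    rewrite in_flip aS in_Sy eqxx orbT yW (negPf aW) /= in_por_sum_point Nyr /=.
    by apply: contraNN aW => /andP[/eqP->].
  by move: aW; rewrite -(amax _ ay) yW.
have aZ : a \in Zy.
  (* The flip places [z] above [a], so maximality of [a] forces z = a. *)
  case/above_ZP: (aW) => [->|[z zZ za]]; rewrite in_Zy ?eqxx ?orbT //.
  have zW : z \in above_Z R by apply: above_Z_Zy; rewrite ?in_Zy ?zZ.
  have <- : z = a by apply: amax; rewrite add_point_above ?za.
  by rewrite zZ.
split=> // b; rewrite -R'Z in_por_restr => /and3P[ab _ _]; exact: amax.
Qed.

Lemma add_pointK : {in extensions, cancel add_point remove_point}.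
Proof.
move=> R; rewrite inE => /andP[porR _].
have := porR => /porP[sub _ _ _].
(* Once the up-set is recovered, [flipK] undoes the flip. *)
have eW : not_below_y (add_point R) = above_Z R.
  apply/setP=> w; rewrite in_setU1 inE.
  have yW : y \in above_Z R by apply/above_ZP; left.
  have [->|wy] := eqVneq w y; first by rewrite yW.
  have [wS|wS] /= := boolP (w \in S); last first.
    by apply/esym; apply: contraNF wS => /(above_Z_Sy porR); rewrite in_Sy (negPf wy) orbF.
  rewrite in_flip !in_Sy wS eqxx orbT yW /= !in_por_sum_point (negPf wy) andbF andFb !orbF.
  case: (w \in above_Z R) => /=; first by apply: contra yS => /sub[].
  by rewrite negbK; apply: contraNF yS => /sub[].
rewrite /remove_point eW /add_point flipK; [|exact: upset_above_Z|exact: por_sum_point].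
apply/setP=> -[a b]; rewrite in_por_restr in_por_sum_point.
apply/and3P/idP => [[/orP[//|/andP[/eqP->]]]|ab].
  by rewrite (negPf yS).
by have [-> ->] := sub _ _ ab; rewrite ab.
Qed.

(** * Deleting the point *)

Section RemovePoint.

Variable R : {set T * T}.
Hypothesis RP : R \in pointed_extensions.

Let W := not_below_y R.
Let G := flip Sy W R.

Let porR : is_por Sy R.
Proof. by move: RP; rewrite inE => /and3P[]. Qed.

Let restrR a b : a \in Zy -> b \in Zy -> ((a, b) \in R) = ((a, b) \in Qy).
Proof.
move: RP; rewrite inE => /and3P[_ /eqP <- _] aZ bZ.
by rewrite in_por_restr aZ bZ !andbT.
Qed.

Let maxR : por_max Sy R = por_max Zy Qy.
Proof. by move: RP; rewrite inE => /and3P[_ _ /eqP]. Qed.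

Let NyQ a : ((a, y) \in Q) = false.
Proof.
case/porP: porQ => sub _ _ _.
by apply: contraNF yS => /sub[_ /(subsetP ZS)].
Qed.

Let yNQ a : ((y, a) \in Q) = false.
Proof.
case/porP: porQ => sub _ _ _.
by apply: contraNF yS => /sub[/(subsetP ZS)].
Qed.

(** The point [y] is isolated in [Qy], hence maximal there, and [R] has the same maximal points. *)
Let y_max b : (y, b) \in R -> b = y.
Proof.
suff /por_maxP[_]: y \in por_max Sy R by apply.
rewrite maxR; apply/por_maxP; split=> [|c]; first by rewrite in_Zy eqxx orbT.
by rewrite in_Qy NyQ eqxx => /eqP.
Qed.

Let yW : y \in W. Proof. by rewrite in_setU1 eqxx. Qed.

Let W_below_y w : w \in W -> (w, y) \in R -> w = y.
Proof. by rewrite in_setU1 inE => /orP[/eqP //|/andP[_ /negP]]. Qed.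

Let W_Sy w : w \in W -> w \in Sy.
Proof. by rewrite in_setU1 inE in_Sy => /orP[->|/andP[->]//]; rewrite orbT. Qed.

Let Z_W z : z \in Z -> z \in W.
Proof.
move=> zZ; rewrite in_setU1 inE (subsetP ZS) //= restrR ?in_Zy ?zZ ?eqxx ?orbT //.
by rewrite in_Qy yNQ neq_y ?(subsetP ZS).
Qed.

(** If [b] above [a] left [W], it would lie below [y], and so would [a]; then a = y, and maximality
    of [y] gives b = y. *)
Let upW : upset W R.
Proof.
have := porR => /porP[sub _ _ trans] a b ab aW.
have [->//|by_] := eqVneq b y.
have [_] := sub _ _ ab; rewrite in_Sy (negPf by_) orbF => bS.
rewrite in_setU1 inE bS (negPf by_) /=; apply/negP=> bY.
have ay := W_below_y aW (trans _ _ _ ab bY).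
by move/eqP: by_; apply; apply: y_max; rewrite -ay.
Qed.

Let porG : is_por Sy G. Proof. exact: flip_por. Qed.

(** In [R] every point outside [W] is below [y], so complementing leaves no crossing pair at [y];
    inside [W], only [y] is comparable to [y]. *)
Let y_isolated a b : (a, b) \in G -> (a == y) || (b == y) -> a = y /\ b = y.
Proof.
rewrite in_flip => /and3P[aS bS ab] /orP[]/eqP ey; subst.
  move: ab; rewrite yW; have [bW /= bY|//] := boolP (b \in W).
  by split=> //; apply: W_below_y.
move: ab; rewrite yW; have [aW /= /y_max //|aW /= aY] := boolP (a \in W).
by case/negP: aW; rewrite in_setU1 inE aY andbT orbC -in_Sy.
Qed.

(** Since [Z] lies in [W], the flip dualizes the copy of the dual of [Q] back to [Q]. *)
Lemma remove_point_extension : remove_point R \in extensions.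
Proof.
rewrite inE (por_restr_por _ porG) ?subsetUl //=.
apply/eqP/setP=> -[a b]; rewrite !in_por_restr.
apply/and3P/idP => [[/and3P[ab _ _] aZ bZ]|ab].
  move: ab; rewrite in_flip !Z_W // restrR ?in_Zy ?aZ ?bZ // in_Qy.
  by case/and3P=> _ _ /orP[//|/andP[]]; rewrite neq_y ?(subsetP ZS).
case/porP: porQ => sub _ _ _; have [aZ bZ] := sub _ _ ab.
split=> //; rewrite !(subsetP ZS) // in_flip !Z_W // !W_Sy ?Z_W //.
by rewrite restrR ?in_Zy ?aZ ?bZ // in_Qy ab.
Qed.

Lemma remove_pointK : add_point (remove_point R) = R.
Proof.
(* As [y] is isolated in [G], deleting and adjoining it again changes nothing. *)
have eG : por_sum (remove_point R) (por_point y) = G.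
  apply/setP=> -[a b]; rewrite in_por_sum_point in_por_restr.
  case/porP: (porG) => sub refl _ _.
  apply/orP/idP => [[/and3P[] //|/andP[/eqP-> /eqP->]]|ab].
    by apply: refl; rewrite in_Sy eqxx orbT.
  have [/y_isolated-/(_ ab)[-> ->]|] := boolP ((a == y) || (b == y)).
    by right; rewrite eqxx.
  rewrite negb_or => /andP[ay by_]; left.
  by have [] := sub _ _ ab; rewrite !in_Sy (negPf ay) (negPf by_) !orbF ab => -> ->.
have eW : above_Z (remove_point R) = W.
  apply/setP=> w; apply/above_ZP/idP => [[->//|[z zZ]]|wW].
    rewrite in_por_restr => /and3P[zw _ _].
    exact: upset_flip zw (Z_W zZ).
  have [->|wy] := eqVneq w y; [by left | right].
  (* The witness in [Z] is a maximal point [m] of [R] above [w]: it lies in [Zy] by the condition on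
     maxima, differs from [y] because [w] is not below [y], and is below [w] after the flip. *)
  have [m wm mmax] := por_exists_max porR (W_Sy wW).
  have mW := upW wm wW.
  have mZ : m \in Z.
    move: mmax; rewrite maxR => /por_maxP[]; rewrite in_Zy => /orP[//|/eqP em] _.
    by rewrite em in wm; case/eqP: wy; apply: W_below_y.
  exists m => //; rewrite in_por_restr in_flip mW wW !W_Sy // wm (subsetP ZS) //=.
  by have := W_Sy wW; rewrite in_Sy (negPf wy) orbF.
by rewrite /add_point eG eW flipK.
Qed.

End RemovePoint.

(** * Equality of the two numbers *)

Lemma card_extensions : #|extensions| = #|pointed_extensions|.
Proof.
apply/eqP; rewrite eqn_leq (leq_card_can add_point_pointed add_pointK) /=.
exact: leq_card_can remove_point_extension remove_pointK.
Qed.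

End Bijection.

Theorem theorem2 (T : finType) (X Z : {set T}) (Q : {set T * T}) (y : T)
  (dXZ : [disjoint X & Z]) (porQ : is_por Z Q) (yXZ : y \notin X :|: Z) :
  #|[set R : {set T * T} | is_por (X :|: Z) R & por_restr R Z == Q]|
  = #|[set R : {set T * T} |
       [&& is_por (X :|: Z :|: [set y]) R,
           por_restr R (Z :|: [set y]) == por_sum (por_dual Q) (por_point y) &
           por_max (X :|: Z :|: [set y]) R
           == por_max (Z :|: [set y]) (por_sum (por_dual Q) (por_point y))]]|.
Proof. exact: card_extensions (subsetUr X Z) porQ yXZ. Qed.
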